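(* If $u_k$ and $v_k$ satisfy $$u_{k+1}=-k\,u_k-\sum_{l=1}^{k-1}\binom{k+1}{l}u_l+1,\qquad u_1=0,\quad k\ge1,$$ $$v_{k+1}=-k\,v_k-\sum_{l=1}^{k-1}\binom{k+1}{l}v_l-\delta_{0k},\qquad k\ge0,$$ then $$\sum_{i=0}^{p-1} i!\,i^k\not\equiv v_k\pmod p,\qquad p>2,$$ is equivalent to Kurepa's hypothesis (KH) for such $k\in\mathbb N$ for which $u_k$ is not divisible by $p$.
   Context: Here $p$ denotes a prime number, $\mathbb N$ is the set of positive integers, $\delta_{0k}$ is the Kronecker symbol, and empty sums are $0$ (so the second recurrence at $k=0$ gives $v_1=-1$). The left factorial is $!n=\sum_{i=0}^{n-1} i!$. Kurepa's hypothesis (KH) is the statement that $\gcd(!n,n!)=2$ for all integers $n\ge2$; a known equivalent form is $!p\not\equiv0\pmod p$ for all primes $p>2$. *)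

(* Defs.v *)
From mathcomp Require Import all_boot all_order all_algebra.

Set Implicit Arguments.
Unset Strict Implicit.
Unset Printing Implicit Defensive.

Import Order.TTheory GRing.Theory Num.Theory.

Local Open Scope nat_scope.

Definition left_factorial (n : nat) : nat := \sum_(0 <= i < n) i`!.

Definition kurepa_hypothesis : Prop :=
  forall n : nat, 2 <= n -> gcdn (left_factorial n) n`! = 2.

Definition fact_power_sum (k n : nat) : nat := \sum_(0 <= i < n) i`! * i ^ k.

Local Open Scope ring_scope.

(* The value u 0 is unconstrained; only indices k >= 1 are meaningful. *)
Definition u_recurrence (u : nat -> int) : Prop :=
  u 1%N = 0 /\
  forall k : nat, (1 <= k)%N ->
    u k.+1 = - (k%:R * u k) - \sum_(1 <= l < k) 'C(k.+1, l)%:R * u l + 1.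

(* At k = 0 the sum is empty and v 0 is multiplied by 0, so v 1 = -1 and v 0 is
   unconstrained; the last term is the Kronecker symbol. *)
Definition v_recurrence (v : nat -> int) : Prop :=
  forall k : nat,
    v k.+1 =
      - (k%:R * v k) - \sum_(1 <= l < k) 'C(k.+1, l)%:R * v l - (0%N == k)%:R.

(* Main.v *)
Require Import Defs.
From mathcomp Require Import all_boot all_order all_algebra.
From mathcomp Require Import zify ring.

Set Implicit Arguments.
Unset Strict Implicit.
Unset Printing Implicit Defensive.

Import Order.TTheory GRing.Theory Num.Theory.
Local Open Scope ring_scope.

(** Write S_k for the sum of i! i^k over i < n, so that S_0 = !n.  Since
    (i+1)! (i+1)^k = i! (i+1)^(k+1), telescoping (i+1)! (i+1)^k - i! i^k over
    i < n and expanding (i+1)^(k+1) by the binomial formula expresses S_(k+1)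
    linearly through S_0, ..., S_k, up to the boundary term n! n^k
    ([fact_power_sum_telescope]).  The sequences u and v satisfy the same linear
    recurrence with different source terms: that of u is 1, the coefficient of
    S_0 up to sign, and that of v is -0^k, the other boundary term.  Hence
    S_k = v_k - u_k !n modulo n! ([fact_power_sum_mod_fact]).

    For n = p prime this says that p divides S_k - v_k exactly when it divides
    u_k !p, so when p does not divide u_k the condition on S_k is the condition
    that p does not divide !p.  The latter, for all odd primes, is Kurepa's
    hypothesis ([kurepa_hypothesis_primeP]): !n = !p modulo p for all n >= p,
    which controls the odd prime factors of gcd(!n, n!), while !n = 2 modulo 4
    for n >= 4, with a look at n = 2 and n = 3, controls the power of 2.  When k
    varies with p, the choice k = 2 is always admissible because u_2 = 1. *)

Lemma fact_power_sum0 n : fact_power_sum 0 n = left_factorial n.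
Proof. by apply: eq_bigr => i _; rewrite expn0 muln1. Qed.

(** The telescoping identity, with all terms moved to the side where they are
    natural numbers.  The convention 0 ^ 0 = 1 makes the lower boundary term the
    Kronecker symbol. *)
Lemma fact_power_sum_telescope k n :
  (\sum_(0 <= l < k.+2) 'C(k.+1, l) * fact_power_sum l n + 0 ^ k
     = n`! * n ^ k + fact_power_sum k n)%N.
Proof.
elim: n => [|n IHn].
  rewrite big1 => [|l _]; first by rewrite /fact_power_sum big_geq // mul1n addn0.
  by rewrite /fact_power_sum big_geq // muln0.
have sumS l : fact_power_sum l n.+1 = (fact_power_sum l n + n`! * n ^ l)%N.
  by rewrite /fact_power_sum big_nat_recr.
have binom : (\sum_(0 <= l < k.+2) 'C(k.+1, l) * (n`! * n ^ l)
                = n.+1`! * n.+1 ^ k)%N.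
  rewrite factS [RHS]mulnAC -expnS [RHS]mulnC -[in RHS]add1n expnDn.
  rewrite big_mkord big_distrr /=; apply: eq_bigr => i _.
  by rewrite exp1n mul1n mulnCA.
under eq_bigr => l _ do rewrite sumS mulnDr.
rewrite big_split /= binom sumS; lia.
Qed.

Lemma fact_power_sum1 n : (fact_power_sum 1 n)%:Z = n`!%:Z - 1.
Proof.
have := fact_power_sum_telescope 0 n.
rewrite !big_nat_recr //= big_geq // bin0 binn; lia.
Qed.

Lemma fact_power_sum_rec k n : (1 <= k)%N ->
  (fact_power_sum k.+1 n)%:Z =
    - (k%:R * (fact_power_sum k n)%:Z)
    - \sum_(1 <= l < k) 'C(k.+1, l)%:R * (fact_power_sum l n)%:Z
    - (left_factorial n)%:Z + n`!%:Z * n%:Z ^+ k.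
Proof.
move=> k_gt0; have := fact_power_sum_telescope k n.
rewrite !big_nat_recr //= big_ltn // binn bin0 binSn exp0n // fact_power_sum0.
move=> /(congr1 Posz); rewrite !(PoszD, PoszM).
have -> : (n ^ k)%N%:Z = n%:Z ^+ k by rewrite -[LHS]natz natrX natz.
have -> : (\sum_(1 <= l < k) 'C(k.+1, l) * fact_power_sum l n)%N%:Z
        = \sum_(1 <= l < k) 'C(k.+1, l)%:R * (fact_power_sum l n)%:Z.
  rewrite -[LHS]natz natr_sum; apply: eq_bigr => l _.
  by rewrite natrM !natz.
rewrite -[k.+1%:Z]/(1 + k)%:Z PoszD !natz => E.
set s := \sum_(1 <= l < k) _ in E *.
lia.
Qed.

(** The defect S_k - v_k + u_k !n satisfies the homogeneous version of the
    recurrence up to a multiple of n!, and its initial value at k = 1 is n!. *)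
Lemma fact_power_sum_mod_fact (u v : nat -> int) k n :
  u_recurrence u -> v_recurrence v -> (1 <= k)%N ->
  (n`!%:Z %| (fact_power_sum k n)%:Z - v k + u k * (left_factorial n)%:Z)%Z.
Proof.
move=> [u1 uS] vS; elim/ltn_ind: k => -[//|[_ _|k IHk _]].
  by rewrite fact_power_sum1 u1 vS big_geq //=; apply/dvdzP; exists 1; ring.
rewrite fact_power_sum_rec // uS // vS /= subr0.
set K := (left_factorial n)%:Z; set F := n`!%:Z.
set D := fun l => (fact_power_sum l n)%:Z - v l + u l * K.
have F_dvd_sum : (F %| \sum_(1 <= l < k.+1) 'C(k.+2, l)%:R * D l)%Z.
  rewrite big_nat; apply: rpred_sum => l /andP[l_gt0 l_lt].
  by apply: dvdz_mull; apply: IHk => //; apply: ltnW.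
(* Linearity of the recurrences: the three sums combine into one over D. *)
have sumE : \sum_(1 <= l < k.+1) 'C(k.+2, l)%:R * D l
    = \sum_(1 <= l < k.+1) 'C(k.+2, l)%:R * (fact_power_sum l n)%:Z
      - \sum_(1 <= l < k.+1) 'C(k.+2, l)%:R * v l
      + (\sum_(1 <= l < k.+1) 'C(k.+2, l)%:R * u l) * K.
  by rewrite mulr_suml -sumrB -big_split /=; apply: eq_bigr => l _; rewrite /D; ring.
have -> : - (k.+1%:R * (fact_power_sum k.+1 n)%:Z)
      - \sum_(1 <= l < k.+1) 'C(k.+2, l)%:R * (fact_power_sum l n)%:Z
      - K + F * n%:Z ^+ k.+1
      - (- (k.+1%:R * v k.+1) - \sum_(1 <= l < k.+1) 'C(k.+2, l)%:R * v l)
      + (- (k.+1%:R * u k.+1)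
         - \sum_(1 <= l < k.+1) 'C(k.+2, l)%:R * u l + 1) * K
    = F * n%:Z ^+ k.+1 - k.+1%:R * D k.+1
      - \sum_(1 <= l < k.+1) 'C(k.+2, l)%:R * D l.
  by rewrite sumE /D; ring.
apply: rpredB => //; apply: rpredB; first exact: dvdz_mulr.
by apply: dvdz_mull; apply: IHk.
Qed.

(** All terms i! with p <= i vanish modulo p. *)
Lemma dvdn_left_factorial p n : (0 < p <= n)%N ->
  (p %| left_factorial n)%N = (p %| left_factorial p)%N.
Proof.
case/andP=> p_gt0 le_pn; rewrite /left_factorial (big_cat_nat (leq0n p) le_pn) /=.
apply: dvdn_addl; rewrite big_nat; apply: dvdn_sum => i /andP[le_pi _].
by rewrite dvdn_fact // p_gt0.
Qed.

Lemma left_factorial_even n : (2 <= n)%N -> (2 %| left_factorial n)%N.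
Proof.
move=> n_ge2; rewrite dvdn_left_factorial //.
by rewrite /left_factorial !big_nat_recr //= big_geq.
Qed.

(** For n >= 4, !n = !4 = 10 modulo 4; for n = 2, 3 it is n! that 4 fails to
    divide. *)
Lemma gcdn_left_factorial_mod4 n : (2 <= n)%N ->
  ~~ (4 %| gcdn (left_factorial n) n`!)%N.
Proof.
move=> n_ge2; rewrite dvdn_gcd; case: (leqP 4 n) => [n_ge4|].
  by rewrite dvdn_left_factorial // /left_factorial !big_nat_recr //= big_geq.
by case: n n_ge2 => [|[|[|[|]]]] // _ _; rewrite andbF.
Qed.

Lemma prime_dvdn_fact_leq p n : prime p -> (p %| n`!)%N -> (p <= n)%N.
Proof.
move=> p_pr; elim: n => [|n IHn]; first by rewrite Euclid_dvd1.
rewrite factS Euclid_dvdM // => /orP[/dvdn_leq -> //|/IHn].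
exact: leqW.
Qed.

(** An odd prime common factor p of !n and n! is at most n, so it divides !p as
    well; in the converse direction !p and p! would share the factor p > 2. *)
Lemma kurepa_hypothesis_primeP :
  kurepa_hypothesis <->
  forall p, prime p -> (2 < p)%N -> ~~ (p %| left_factorial p)%N.
Proof.
split=> [KH p p_pr p_gt2|odd_ndvd n n_ge2].
  apply/negP => p_dvd.
  have : (p %| gcdn (left_factorial p) p`!)%N.
    by rewrite dvdn_gcd p_dvd dvdn_fact // prime_gt0 /=.
  by rewrite KH 1?ltnW // => /(@dvdn_leq p 2 isT); rewrite leqNgt p_gt2.
have := gcdn_left_factorial_mod4 n_ge2.
have /dvdnP[m def_g] : (2 %| gcdn (left_factorial n) n`!)%N.
  by rewrite dvdn_gcd left_factorial_even // dvdn_fact.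
rewrite def_g -[4%N]/(2 * 2)%N dvdn_pmul2r // => m_odd.
case: (ltngtP m 1) => [||-> //]; first by case: m m_odd {def_g}.
move=> /[dup] m_gt1 /pdiv_prime q_pr; have q_dvd := pdiv_dvd m.
set q := pdiv m in q_pr q_dvd.
have [q_gt2|q_le2] := ltnP 2 q; last first.
  have q2 : q = 2%N by have := prime_gt1 q_pr; lia.
  by rewrite q2 (negPf m_odd) in q_dvd.
have : (q %| gcdn (left_factorial n) n`!)%N by rewrite def_g dvdn_mulr.
rewrite dvdn_gcd => /andP[q_lf q_fact].
have le_qn : (q <= n)%N := prime_dvdn_fact_leq q_pr q_fact.
have := odd_ndvd q q_pr q_gt2.
by rewrite -(@dvdn_left_factorial q n) ?q_lf // prime_gt0.
Qed.

(** Modulo p, which divides p!, the defect congruence reads S_k - v_k = - u_k !p,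
    and u_k is invertible. *)
Lemma fact_power_sum_neq_mod (u v : nat -> int) k p :
  u_recurrence u -> v_recurrence v -> (1 <= k)%N -> prime p ->
  ~~ (p%:Z %| u k)%Z ->
  ((fact_power_sum k p)%:Z != v k %[mod p%:Z])%Z = ~~ (p %| left_factorial p)%N.
Proof.
move=> hu hv k_gt0 p_pr p_ndvd_u; congr (~~ _); rewrite eqz_mod_dvd.
have p_dvd_fact : (p%:Z %| p`!%:Z)%Z.
  by rewrite dvdzE /= dvdn_fact // prime_gt0 /=.
have := dvdz_trans p_dvd_fact (fact_power_sum_mod_fact p hu hv k_gt0).
move=> defect; apply/idP/idP => [Sv_dvd|lf_dvd].
  move: defect; rewrite rpredDl //.
  by rewrite dvdzE abszM Euclid_dvdM // -dvdzE (negPf p_ndvd_u).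
by move: defect; rewrite rpredDr //; apply: dvdz_mull; rewrite dvdzE.
Qed.

Theorem theorem3 (u v : nat -> int)
    (hu : u_recurrence u) (hv : v_recurrence v) :
  (* for each odd prime p and each k with p not dividing u_k *)
  (forall (k p : nat), (1 <= k)%N -> prime p -> (2 < p)%N ->
     ~~ (p%:Z %| u k)%Z ->
     ((fact_power_sum k p)%:Z != v k %[mod p%:Z])%Z
       <-> (left_factorial p != 0 %[mod p])%N) /\
  (* for each k such that no odd prime divides u_k *)
  (forall k : nat, (1 <= k)%N ->
     (forall p : nat, prime p -> (2 < p)%N -> ~~ (p%:Z %| u k)%Z) ->
     (forall p : nat, prime p -> (2 < p)%N ->
        ((fact_power_sum k p)%:Z != v k %[mod p%:Z])%Z)
       <-> kurepa_hypothesis) /\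
  (* for all admissible pairs (p, k) at once *)
  ((forall (k p : nat), (1 <= k)%N -> prime p -> (2 < p)%N ->
      ~~ (p%:Z %| u k)%Z ->
      ((fact_power_sum k p)%:Z != v k %[mod p%:Z])%Z)
     <-> kurepa_hypothesis).
Proof.
have lf_neq0 p : (left_factorial p != 0 %[mod p])%N = ~~ (p %| left_factorial p)%N.
  by rewrite mod0n.
have neqP k p (k_gt0 : (1 <= k)%N) p_pr :=
  @fact_power_sum_neq_mod u v k p hu hv k_gt0 p_pr.
split=> [k p k_gt0 p_pr _ p_ndvd|]; first by rewrite neqP // lf_neq0.
split=> [k k_gt0 ndvd_u|]; apply: iff_trans (iff_sym kurepa_hypothesis_primeP).
  by split=> H p p_pr p_gt2; have := H p p_pr p_gt2; rewrite neqP // ndvd_u.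
split=> [H p p_pr p_gt2|H k p k_gt0 p_pr p_gt2 p_ndvd]; last first.
  by rewrite neqP //; apply: H.
(* The exponent 2 is admissible for every p. *)
have u2 : u 2%N = 1 by case: hu => u1 -> //; rewrite big_geq // u1.
have p_ndvd : ~~ (p%:Z %| u 2%N)%Z.
  by rewrite u2 dvdzE /= dvdn1; case: eqP p_gt2 => // ->.
by rewrite -(neqP 2%N) //; apply: H.
Qed.
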